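(* Let $z_1,z_2,z_3$ be distinct complex numbers with $|z_1|=|z_2|=|z_3|=z_1z_2z_3=1$, and let the large triangle be the triangle with vertices $z_1-z_2-z_3$, $-z_1+z_2-z_3$, $-z_1-z_2+z_3$; its nine-point circle is the unit circle. For real $\theta$ let $\alpha=e^{i\theta}$ and $\alpha'=-\alpha$. Let $\varepsilon$ and $\varepsilon'$ be the opposite ends of the diameter of the circumcircle of the large triangle that is parallel to the diameter of its nine-point circle connecting $\alpha$ and $\alpha'$, and assume that, when moving along these two diameters in the same direction, $\varepsilon$ and $\varepsilon'$ occur in the same order as do $\alpha$ and $\alpha'$. Then the Simson lines of $\varepsilon$ and $\varepsilon'$ with respect to the large triangle are $L$ and $L'$, respectively, where $L$ is the line connecting $e^{-2i\theta}+2e^{i\theta}$ and $-e^{-2i\theta}$, and $L'$ is the line connecting $e^{-2i\theta}-2e^{i\theta}$ and $-e^{-2i\theta}$. As $\theta$ varies over the real numbers, the lines $L$ form a family of lines whose envelope is the standard deltoid, and likewise the lines $L'$ form a family of lines whose envelope is the standard deltoid.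
   Context: The plane is identified with $\mathbb{C}$. The standard deltoid is $\Delta=\{2e^{i\varphi}+e^{-2i\varphi}:\varphi\in\mathbb{R}\}$, equivalently the set of $z$ with $z^2\bar z^2-4(z^3+\bar z^3)+18z\bar z-27=0$. The tangent line to $\Delta$ at $2e^{i\varphi}+e^{-2i\varphi}$ is the line through that point with direction $e^{-i\varphi/2}$; at the three cusps ($e^{3i\varphi}=1$) this is the limiting tangent line. For the exceptional $\theta$ at which the two points defining $L$ (namely when $e^{3i\theta}=-1$) or $L'$ (when $e^{3i\theta}=1$) coincide, the line is understood as the limit as $\theta$ tends to that value; so $L$ is the line through $-e^{-2i\theta}$ with direction $e^{-i\theta/2}$ and $L'$ is the line through $-e^{-2i\theta}$ with direction $ie^{-i\theta/2}$. The Simson line of a point $P$ on the circumcircle of a triangle is the line containing the orthogonal projections of $P$ onto the three sidelines. Envelope: $\Delta$ is the envelope of a family of lines if every line of the family is tangent to $\Delta$ and every point of $\Delta$ is a point of tangency of some line of the family. *)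

(* Defs.v *)
From Stdlib Require Import Reals.
From Coquelicot Require Import Coquelicot.
Open Scope R_scope.

Definition cis (t : R) : C := (cos t, sin t).

(** Euclidean inner product of plane vectors. *)
Definition dot (u v : C) : R := Re (u * Cconj v)%C.

Definition midpoint (p q : C) : C := ((p + q) / 2)%C.

Definition parallel (u v : C) : Prop := exists k : R, k <> 0 /\ u = (k * v)%C.

Definition line (p d : C) : C -> Prop := fun z => exists t : R, z = (p + t * d)%C.

Definition line_through (p q : C) : C -> Prop := line p (q - p)%C.

Definition same_set (S T : C -> Prop) : Prop := forall z : C, S z <-> T z.

Definition is_line (l : C -> Prop) : Prop :=
  exists p d : C, d <> 0%C /\ same_set l (line p d).

Definition on_circle (o : C) (r : R) (p : C) : Prop := Cmod (p - o) = r.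

Definition opposite_ends (o : C) (r : R) (p q : C) : Prop :=
  on_circle o r p /\ on_circle o r q /\ midpoint p q = o.

(** [same_order p q p' q']: moving along the parallel segments [p q] and [p' q'] in a common direction
    [d], one meets [p] before [q] exactly when one meets [p'] before [q']. *)
Definition same_order (p q p' q' : C) : Prop :=
  forall d : C, parallel d (q - p)%C ->
    (dot d p < dot d q <-> dot d p' < dot d q').

Definition is_circumcircle (a b c : C) (o : C) (r : R) : Prop :=
  on_circle o r a /\ on_circle o r b /\ on_circle o r c.

Definition is_orthogonal_projection (p : C) (l : C -> Prop) (f : C) : Prop :=
  l f /\ forall x y : C, l x -> l y -> dot (p - f) (y - x) = 0.

Definition contains_projection (l : C -> Prop) (p : C) (m : C -> Prop) : Prop :=
  exists f : C, is_orthogonal_projection p m f /\ l f.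

Definition contains_projections (l : C -> Prop) (a b c p : C) : Prop :=
  contains_projection l p (line_through b c) /\
  contains_projection l p (line_through c a) /\
  contains_projection l p (line_through a b).

(** [l] is the (unique) line containing the projections of [p], a point of the
    circumcircle, onto the three sidelines. *)
Definition is_simson_line (a b c p : C) (l : C -> Prop) : Prop :=
  (exists (o : C) (r : R), is_circumcircle a b c o r /\ on_circle o r p) /\
  is_line l /\ contains_projections l a b c p /\
  forall m : C -> Prop,
    is_line m -> contains_projections m a b c p -> same_set m l.

Definition is_orthocenter (a b c h : C) : Prop :=
  dot (h - a) (c - b) = 0 /\ dot (h - b) (a - c) = 0 /\ dot (h - c) (b - a) = 0.

(** The circle through the midpoints of the sides, the feet of the altitudes
    and the midpoints between the vertices and the orthocenter. *)
Definition is_nine_point_circle (a b c : C) (o : C) (r : R) : Prop :=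
  (on_circle o r (midpoint b c) /\ on_circle o r (midpoint c a) /\
   on_circle o r (midpoint a b)) /\
  (contains_projection (on_circle o r) a (line_through b c) /\
   contains_projection (on_circle o r) b (line_through c a) /\
   contains_projection (on_circle o r) c (line_through a b)) /\
  (exists h : C, is_orthocenter a b c h /\
     on_circle o r (midpoint a h) /\ on_circle o r (midpoint b h) /\
     on_circle o r (midpoint c h)).

Definition deltoid_point (phi : R) : C := (2 * cis phi + cis (- 2 * phi))%C.

Definition deltoid (z : C) : Prop := exists phi : R, z = deltoid_point phi.

(** [deltoid_point] has derivative [-4 sin (3 phi / 2) cis (- phi / 2)]; at the
    cusps, where it vanishes, this is the limiting tangent line. *)
Definition deltoid_tangent (phi : R) : C -> Prop :=
  line (deltoid_point phi) (cis (- phi / 2)).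

Definition tangent_to_deltoid_at (l : C -> Prop) (z : C) : Prop :=
  exists phi : R, z = deltoid_point phi /\ same_set l (deltoid_tangent phi).

Definition deltoid_is_envelope {I : Type} (F : I -> C -> Prop) : Prop :=
  (forall i : I, exists z : C, tangent_to_deltoid_at (F i) z) /\
  (forall z : C, deltoid z -> exists i : I, tangent_to_deltoid_at (F i) z).

(** The points whose distance to [F t] tends to [0] as [t] tends to [theta],
    [t <> theta]. If the lines [F t] converge, this is the limiting line. *)
Definition limit_set (F : R -> C -> Prop) (theta : R) : C -> Prop := fun z =>
  forall eps : posreal,
    locally' theta (fun t => exists w : C, F t w /\ Cmod (w - z) < eps).

(** The line connecting the moving points [p theta] and [q theta]; if they
    coincide, the limit of the connecting lines. *)
Definition connecting_line (p q : R -> C) (theta : R) : C -> Prop := fun z =>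
  (p theta <> q theta /\ line_through (p theta) (q theta) z) \/
  (p theta = q theta /\
   limit_set (fun t => line_through (p t) (q t)) theta z).

Definition line_L : R -> C -> Prop :=
  connecting_line (fun t => cis (- 2 * t) + 2 * cis t)%C
                  (fun t => - cis (- 2 * t))%C.

Definition line_L' : R -> C -> Prop :=
  connecting_line (fun t => cis (- 2 * t) - 2 * cis t)%C
                  (fun t => - cis (- 2 * t))%C.

(* Main.v *)
Require Import Defs.
From Stdlib Require Import Reals Lra.
From Coquelicot Require Import Coquelicot.
Open Scope R_scope.

(** Write [s] for [z1 + z2 + z3]. The vertices of the large triangle are
    [- s + 2 * z1], [- s + 2 * z2], [- s + 2 * z3], so its circumcircle has
    centre [- s] and radius [2], and [eps], [eps'] are [- s + 2 * al] and
    [- s - 2 * al] with [al = cis theta] ([circumcircle_unique],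
    [ordered_diameter_ends]). On a unit circle, the projection of [al] onto
    the chord [v w] is [(al + v + w - v * w * Cconj al) / 2]
    ([foot_on_chord]); scaling and using [z1 * z2 * z3 = 1], the projections
    of [eps] onto the sidelines are [al - z - Cconj z * Cconj al] for
    [z = z1, z2, z3] ([simson_foot]).

    Since the square of [cis (- phi / 2)] is [Cconj (cis phi)], the tangent to
    the deltoid with parameter [phi] is the set of [z] with
    [Cconj z + be ^ 2 = be * z + Cconj be], where [be = cis phi]
    ([deltoid_tangent_iff]). The three projections satisfy this equation with
    [be = al]. Two of them coincide only if [al] is the third [z]
    ([simson_feet_eq]), hence they are not all equal and the tangent is the
    only line through them ([tangent_is_simson_line]). The same holds for
    [eps'] with [- al = cis (theta + PI)] in place of [al].

    It remains to recognize [L] at [theta] as the tangent with parameter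
    [theta], and [L'] at [theta] as the tangent with parameter [theta + PI]
    ([connecting_line_is_deltoid_tangent]). The difference of the two points
    that define such a line is a real multiple [4 * cos (3 * phi / 2)] of the
    unit vector [cis (- phi / 2)]. The factor has isolated zeros and the unit
    vector is continuous, so where the points coincide the lines still
    converge, to the line with that direction ([limit_set_line]). Both
    families therefore run through all tangents of the deltoid, which is the
    envelope property. *)

(** * Complex conjugation *)

Lemma Cconj_RtoC (r : R) : Cconj r = r.
Proof. unfold Cconj, RtoC; simpl; f_equal; ring. Qed.

Lemma Cconj_half (z : C) : Cconj (z / 2)%C = (Cconj z / 2)%C.
Proof.
  rewrite Cdiv_conj; [now rewrite Cconj_RtoC | intros H; injection H; lra].
Qed.

Ltac conj_push :=
  repeat first
    [ rewrite Cconj_half | rewrite Cplus_conj | rewrite Cminus_conj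
    | rewrite Cmult_conj | rewrite Copp_conj | rewrite Cconj_conj
    | rewrite Cconj_RtoC ].

Lemma RtoC_nz (r : R) : r <> 0 -> RtoC r <> 0%C.
Proof. intros Hr H; apply Hr; now apply RtoC_inj. Qed.

Lemma Cmult_reg_l (a x y : C) : a <> 0%C -> (a * x)%C = (a * y)%C -> x = y.
Proof.
  intros Ha H.
  replace x with (/ a * (a * x))%C by (field; exact Ha).
  rewrite H; field; exact Ha.
Qed.

Lemma Cconj_nz (z : C) : z <> 0%C -> Cconj z <> 0%C.
Proof.
  intros Hz H; apply Hz; rewrite <- (Cconj_conj z), H; apply Cconj_RtoC.
Qed.

Lemma Im_0_iff (z : C) : Im z = 0 <-> Cconj z = z.
Proof.
  destruct z as [x y]; unfold Cconj; simpl; split.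
  - intros ->; f_equal; ring.
  - intros H; injection H; lra.
Qed.

Lemma unit_conj (u : C) : Cmod u = 1 -> (u * Cconj u)%C = 1%C.
Proof. intros H; rewrite <- Cmod2_conj, H; f_equal; ring. Qed.

Lemma conj_of_unit_product (u v w : C) :
  Cmod u = 1 -> (u * v * w)%C = 1%C -> (v * w)%C = Cconj u.
Proof.
  intros Hu Hp; apply unit_conj in Hu.
  transitivity (u * v * w * Cconj u)%C; [ring [Hu] | rewrite Hp; ring].
Qed.

Lemma unit_nz (u : C) : Cmod u = 1 -> u <> 0%C.
Proof. intros H; apply Cmod_gt_0; lra. Qed.

(** * Lines and orthogonal projections *)

Lemma line_iff_Im (p d z : C) :
  d <> 0%C -> line p d z <-> Im ((z - p) * Cconj d)%C = 0.
Proof.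
  intros Hd; rewrite Im_0_iff; split.
  - intros [t ->]; conj_push; ring.
  - intros H.
    exists (Re ((z - p) * Cconj d)%C / Cmod d ^ 2).
    assert (Cmod d ^ 2 <> 0)
      by (apply pow_nonzero, Rgt_not_eq, Cmod_gt_0, Hd).
    rewrite RtoC_div, Cmod2_conj, re_alt, H by assumption.
    field.
    repeat split; auto using Cconj_nz.
Qed.

Lemma line_iff (p d z : C) :
  d <> 0%C ->
  line p d z <-> (Cconj (z - p) * d = (z - p) * Cconj d)%C.
Proof.
  intros Hd; rewrite line_iff_Im, Im_0_iff, Cmult_conj, Cconj_conj by exact Hd.
  reflexivity.
Qed.

Lemma line_two_points (p d f g : C) :
  line p d f -> line p d g -> f <> g -> same_set (line p d) (line_through f g).
Proof.
  intros [s ->] [t ->] Hfg.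
  assert (Hst : (RtoC t - RtoC s)%C <> 0%C).
  { intros H; apply Hfg; apply Ceq_minus in H; now rewrite H. }
  intros z; split; intros [x ->].
  - exists ((x - s) / (t - s)).
    rewrite RtoC_div, !RtoC_minus.
    + field; exact Hst.
    + intros H; apply Hst; now rewrite <- RtoC_minus, H.
  - exists (s + x * (t - s)).
    rewrite RtoC_plus, RtoC_mult, RtoC_minus; ring.
Qed.

Lemma dot_0_iff (u v : C) : dot u v = 0 <-> (u * Cconj v + Cconj u * v = 0)%C.
Proof.
  unfold dot; rewrite <- (Cconj_conj v) at 3; rewrite <- Cmult_conj.
  split; intros H.
  - transitivity (2 * Re (u * Cconj v))%C.
    + rewrite re_alt; field.
    + rewrite H; ring.
  - apply RtoC_inj; rewrite re_alt, H; field.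
Qed.

(** Both [p - f] and [p - g] are orthogonal to [g - f], hence so is their
    difference [g - f] itself. *)
Lemma orthogonal_projection_unique (p : C) (l : C -> Prop) (f g : C) :
  is_orthogonal_projection p l f -> is_orthogonal_projection p l g -> f = g.
Proof.
  intros [Hf Pf] [Hg Pg].
  specialize (Pf f g Hf Hg); specialize (Pg f g Hf Hg).
  destruct p as [p1 p2], f as [f1 f2], g as [g1 g2].
  unfold dot in *; simpl in *.
  assert (H1 : (g1 - f1) * (g1 - f1) + (g2 - f2) * (g2 - f2) = 0) by lra.
  destruct (Rplus_sqr_eq_0 (g1 - f1) (g2 - f2) H1).
  f_equal; lra.
Qed.

Lemma orthogonal_projection_intro (p a b f : C) :
  line_through a b f -> dot (p - f) (b - a) = 0 ->
  is_orthogonal_projection p (line_through a b) f.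
Proof.
  intros Hf Hd; split; [exact Hf |].
  intros x y [s ->] [t ->].
  apply dot_0_iff in Hd; apply dot_0_iff.
  transitivity ((t - s) *
     ((p - f) * Cconj (b - a) + Cconj (p - f) * (b - a)))%C.
  - conj_push; ring.
  - rewrite Hd; ring.
Qed.

(** For unit [u], [v] the chord direction satisfies
    [Cconj (v - u) = - (v - u) * Cconj (u * v)], so reflection in the chord
    sends a unit [al] to [u + v - u * v * Cconj al]; the foot is the midpoint
    of [al] and this reflection. *)
Lemma foot_on_chord (o al u v : C) (r : R) :
  Cmod al = 1 -> Cmod u = 1 -> Cmod v = 1 -> u <> v -> r <> 0 ->
  is_orthogonal_projection (o + r * al)%C
    (line_through (o + r * u) (o + r * v))%C
    (o + r * ((al + u + v - u * v * Cconj al) / 2))%C.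
Proof.
  intros Ha Hu Hv Huv Hr.
  apply unit_conj in Ha; apply unit_conj in Hu; apply unit_conj in Hv.
  apply orthogonal_projection_intro.
  - apply line_iff.
    + replace (o + r * v - (o + r * u))%C with (r * (v - u))%C by ring.
      apply Cmult_neq_0; [now apply RtoC_nz |].
      apply Cminus_eq_contra; congruence.
    + conj_push.
      field_simplify_eq; cbv beta.
      ring [Ha Hu Hv].
  - apply dot_0_iff; conj_push.
    field_simplify_eq; cbv beta.
    ring [Ha Hu Hv].
Qed.

(** * The circumcircle and its diameter *)

(** Equal distance from [o] to two points of the circle around [c] forces
    [c - o] to be orthogonal to their chord, and no nonzero vector is
    orthogonal to two chords with a common endpoint. *)
Lemma circumcircle_unique (c u v w o : C) (rho r : R) :
  0 < rho -> Cmod u = 1 -> Cmod v = 1 -> Cmod w = 1 ->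
  u <> v -> u <> w -> v <> w ->
  is_circumcircle (c + rho * u)%C (c + rho * v)%C (c + rho * w)%C o r ->
  o = c /\ r = rho.
Proof.
  intros Hrho Hu Hv Hw Huv Huw Hvw [Ka [Kb Kc]].
  (* Orthogonality to the chord [x y] in conjugate form: the squared chord
     direction is a negative multiple of [x * y]. *)
  assert (Hpair : forall x y : C, Cmod x = 1 -> Cmod y = 1 -> x <> y ->
    on_circle o r (c + rho * x)%C -> on_circle o r (c + rho * y)%C ->
    (Cconj (c - o) = (c - o) * Cconj x * Cconj y)%C).
  { intros x y Hx Hy Hxy Cx Cy; unfold on_circle in *.
    pose proof (Cmod2_conj (c + rho * x - o)) as E.
    rewrite Cx, <- Cy, Cmod2_conj in E.
    apply unit_conj in Hx; apply unit_conj in Hy.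
    revert E; conj_push; intros E.
    apply Ceq_minus in E.
    apply Cmult_reg_l with (rho * (y - x))%C.
    - apply Cmult_neq_0; [apply RtoC_nz; lra |].
      apply Cminus_eq_contra; congruence.
    - apply Ceq_minus.
      rewrite <- E.
      ring [Hx Hy]. }
  assert (Hc : (c - o = 0)%C).
  { pose proof (Hpair u v Hu Hv Huv Ka Kb) as E1.
    pose proof (Hpair u w Hu Hw Huw Ka Kc) as E2.
    rewrite E1 in E2.
    apply Cmult_reg_l with (Cconj u * (Cconj v - Cconj w))%C.
    - apply Cmult_neq_0; [now apply Cconj_nz, unit_nz |].
      rewrite <- Cminus_conj; apply Cconj_nz, Cminus_eq_contra, Hvw.
    - apply Ceq_minus in E2. rewrite Cmult_0_r, <- E2; ring. }
  apply Ceq_minus in Hc; subst o; split; [reflexivity |].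
  unfold on_circle in Ka.
  rewrite <- Ka.
  replace (c + rho * u - c)%C with (rho * u)%C by ring.
  rewrite Cmod_mult, Hu, Cmod_R, Rabs_pos_eq; lra.
Qed.

(** Parallelism leaves [p = o + k * al] with [k] equal to [r] up to sign; the
    common order of the ends is what rules out the negative sign. *)
Lemma ordered_diameter_ends (o p q al : C) (r : R) :
  Cmod al = 1 ->
  opposite_ends o r p q ->
  parallel (q - p)%C (- al - al)%C ->
  same_order p q al (- al)%C ->
  p = (o + r * al)%C /\ q = (o + r * - al)%C.
Proof.
  intros Hal [Hp [_ Ho]] [k [Hk E]] Hord.
  assert (Kp : p = (o + k * al)%C).
  { rewrite <- Ho; unfold midpoint.
    replace q with (p + (q - p))%C by ring; rewrite E; field. }
  assert (Kq : q = (o + k * - al)%C).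
  { transitivity (p + (q - p))%C; [ring |]. rewrite E, Kp; ring. }
  assert (Hr : r = Rabs k).
  { rewrite <- Hp, Kp. replace (o + k * al - o)%C with (k * al)%C by ring.
    rewrite Cmod_mult, Hal, Cmod_R; ring. }
  (* Moving in the direction [q - p = - 2 * k * al], the inner products with
     it increase by [4 * k ^ 2] from [p] to [q], and by [4 * k] from [al] to
     [- al]. *)
  assert (Hpos : 0 < k).
  { specialize (Hord (q - p)%C).
    destruct Hord as [Hord _].
    { exists 1; split; [lra | ring]. }
    assert (Hn : Re al * Re al + Im al * Im al = 1).
    { pose proof (Cmod2_alt al) as H; rewrite Hal in H; lra. }
    assert (0 < k * k) by (apply Rsqr_pos_lt; exact Hk).
    rewrite E, Kp, Kq in Hord.
    destruct al as [x y], o as [o1 o2].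
    unfold dot in Hord; simpl in Hord, Hn.
    assert (E2 : k * k = k * k * x * x + k * k * y * y)
      by (transitivity (k * k * (x * x + y * y)); [rewrite Hn |]; ring).
    assert (E1 : k = k * x * x + k * y * y)
      by (transitivity (k * (x * x + y * y)); [rewrite Hn |]; ring).
    assert (Hlt : forall a b a' b' : R, (a < b -> a' < b') ->
      0 < b - a -> 0 < b' - a') by (intros; lra).
    eapply Hlt in Hord.
    - match type of Hord with 0 < ?e => replace e with (4 * k) in Hord end.
      + lra.
      + rewrite E1 at 1; ring.
    - match goal with |- 0 < ?e => replace e with (4 * (k * k)) end.
      + lra.
      + rewrite E2 at 1; ring. }
  rewrite Rabs_pos_eq in Hr by lra; subst r; now split.
Qed.

(** * Tangents of the deltoid *)

Lemma cis_plus (a b : R) : cis (a + b) = (cis a * cis b)%C.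
Proof.
  unfold cis, Cmult; simpl; rewrite cos_plus, sin_plus; f_equal; ring.
Qed.

Lemma cis_opp (a : R) : cis (- a) = Cconj (cis a).
Proof. unfold cis, Cconj; simpl; now rewrite cos_neg, sin_neg. Qed.

Lemma cis_m2 (a : R) : cis (- 2 * a) = (Cconj (cis a) * Cconj (cis a))%C.
Proof.
  replace (- 2 * a) with (- a + - a) by ring.
  now rewrite cis_plus, cis_opp.
Qed.

Lemma cis_PI (a : R) : cis (a + PI) = (- cis a)%C.
Proof. unfold cis, Copp; simpl; now rewrite neg_cos, neg_sin. Qed.

Lemma Cmod_cis (a : R) : Cmod (cis a) = 1.
Proof.
  unfold Cmod, cis; simpl.
  replace (_ + _) with 1; [exact sqrt_1 |].
  pose proof (sin2_cos2 a) as H; unfold Rsqr in H; lra.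
Qed.

Lemma cis_half (a : R) : (cis (- a / 2) * cis (- a / 2) = Cconj (cis a))%C.
Proof. rewrite <- cis_plus, <- cis_opp; f_equal; field. Qed.

(** A line with unit direction [d] through [p] has the equation
    [Cconj (z - p) = Cconj d ^ 2 * (z - p)], and [Cconj d ^ 2] is [cis phi]
    here. The equation depends on [phi] through [cis phi] alone, although
    [cis (- phi / 2)] changes sign under [phi + 2 * PI]. *)
Lemma deltoid_tangent_iff (phi : R) (z : C) :
  deltoid_tangent phi z <->
  (Cconj z + cis phi * cis phi = cis phi * z + Cconj (cis phi))%C.
Proof.
  pose proof (unit_conj _ (Cmod_cis (- phi / 2))) as Hd.
  pose proof (cis_half phi) as Hdd.
  pose proof (f_equal Cconj Hdd) as Hee.
  rewrite Cmult_conj, Cconj_conj in Hee.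
  unfold deltoid_tangent, deltoid_point.
  rewrite line_iff by apply unit_nz, Cmod_cis.
  rewrite cis_m2; conj_push.
  set (d := cis (- phi / 2)) in *; set (e := Cconj d) in *.
  set (al := cis phi) in *; set (be := Cconj al) in *.
  split; intros H; apply Ceq_minus; apply Ceq_minus in H.
  (* The two equations differ by the unit factor [e], whose inverse is [d]. *)
  - transitivity (e * 0)%C; [rewrite <- H | ring].
    rewrite <- Hee, <- Hdd; ring [Hd].
  - transitivity (d * 0)%C; [rewrite <- H | ring].
    rewrite <- Hee, <- Hdd; ring [Hd].
Qed.

(** * Limits of moving lines *)

Lemma Rabs_Im_le_Cmod (z : C) : Rabs (Im z) <= Cmod z.
Proof.
  apply Rle_trans with (2 := Rmax_Cmod z); apply Rmax_r.
Qed.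

Lemma continuous_cis (g : R -> R) (x : R) :
  continuous g x -> continuous (fun t => cis (g t)) x.
Proof.
  intros Hg; apply (continuous_comp g cis x Hg).
  unfold cis.
  apply (continuous_comp_2 cos sin (fun a b => (a, b) : C)).
  - apply continuous_cos.
  - apply continuous_sin.
  - apply continuous_ext with (f := fun p : R * R => p).
    + now intros [a b].
    + apply continuous_id.
Qed.

(** The signed distance of [z] to the moving line,
    [Im ((z - q t) * Cconj (d t))], is continuous in [t]. If [z] is in the
    limit set, this quantity is arbitrarily small near [theta], hence zero at
    [theta]. Conversely [q t + s * d t] tends to [q theta + s * d theta]. *)
Lemma limit_set_line (q d : R -> C) (theta : R) :
  continuous q theta -> continuous d theta -> (forall t, Cmod (d t) = 1) ->
  same_set (limit_set (fun t => line (q t) (d t)) theta)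
           (line (q theta) (d theta)).
Proof.
  intros Hq Hd Hu z.
  assert (Hc : forall (f : R -> C), continuous f theta ->
    continuous (fun t => fst (f t)) theta /\
    continuous (fun t => snd (f t)) theta).
  { intros f Hf; split; apply (continuous_comp f _ theta Hf).
    - destruct (f theta); apply continuous_fst.
    - destruct (f theta); apply continuous_snd. }
  destruct (Hc q Hq) as [Hq1 Hq2]; destruct (Hc d Hd) as [Hd1 Hd2].
  split.
  - intros Hz; apply line_iff_Im; [now apply unit_nz |].
    set (h := fun t => Im ((z - q t) * Cconj (d t))%C).
    assert (Hh : continuous h theta).
    { apply continuous_ext with (f := fun t =>
        minus (mult (minus (snd z) (snd (q t))) (fst (d t)))
              (mult (minus (fst z) (fst (q t))) (snd (d t)))).
      - intros t; unfold h, minus, plus, opp, mult; simpl; ring.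
      - apply (continuous_minus (V := R_NormedModule));
          apply (continuous_mult (K := R_AbsRing)); try assumption;
          apply (continuous_minus (V := R_NormedModule));
          try assumption; apply continuous_const. }
    change (h theta = 0).
    apply Rabs_eq_0.
    apply Rle_antisym; [| apply Rabs_pos].
    apply le_epsilon; intros eps Heps.
    assert (He : 0 < eps / 2) by lra.
    set (e := mkposreal (eps / 2) He).
    specialize (Hz e).
    assert (Hnear : locally' theta (fun t => Rabs (h t - h theta) < e)).
    { apply filter_le_within.
      apply (proj1 (filterlim_locally h (h theta)) Hh e). }
    (* [Rbar_locally'] at a finite point is [locally'], here with its
       instance of a proper filter. *)
    destruct (filter_ex (F := Rbar_locally' theta) _ (filter_and _ _ Hz Hnear))
      as [t [[w [Hw Hwz]] Ht]].
    apply line_iff_Im in Hw; [| now apply unit_nz].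
    assert (Hht : Rabs (h t) <= Cmod (w - z)).
    { replace (h t) with (Im ((z - w) * Cconj (d t))%C).
      - eapply Rle_trans; [apply Rabs_Im_le_Cmod |].
        rewrite Cmod_mult, Cmod_conj, Hu, <- (Cmod_opp (w - z)).
        right; rewrite Rmult_1_r; f_equal; ring.
      - transitivity (h t - Im ((w - q t) * Cconj (d t))%C).
        + unfold h; simpl; ring.
        + rewrite Hw; ring. }
    simpl in *.
    pose proof (Rabs_triang_inv2 (h theta) (h t)) as T.
    rewrite Rabs_minus_sym in Ht.
    pose proof (Rle_abs (Rabs (h theta) - Rabs (h t))).
    lra.
  - intros [s ->] eps.
    set (g := fun t => Cmod ((q t + s * d t) - (q theta + s * d theta))%C).
    assert (Hg : continuous g theta).
    { apply continuous_ext with (f := fun t => sqrt (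
        plus (mult (minus (plus (fst (q t)) (scal s (fst (d t))))
                          (fst (q theta) + s * fst (d theta)))
                   (minus (plus (fst (q t)) (scal s (fst (d t))))
                          (fst (q theta) + s * fst (d theta))))
             (mult (minus (plus (snd (q t)) (scal s (snd (d t))))
                          (snd (q theta) + s * snd (d theta)))
                   (minus (plus (snd (q t)) (scal s (snd (d t))))
                          (snd (q theta) + s * snd (d theta)))))).
      - intros t; unfold g, Cmod; f_equal.
        unfold minus, plus, opp, mult, scal; simpl; unfold mult; simpl; ring.
      - apply continuous_sqrt_comp.
        apply (continuous_plus (V := R_NormedModule));
          apply (continuous_mult (K := R_AbsRing));
          apply (continuous_minus (V := R_NormedModule));
          try apply continuous_const;
          apply (continuous_plus (V := R_NormedModule)); try assumption;
          apply (continuous_scal_r (V := R_NormedModule)); assumption. }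
    apply filter_le_within.
    pose proof (proj1 (filterlim_locally g (g theta)) Hg eps) as Hloc.
    apply filter_imp with (2 := Hloc); intros t Ht.
    exists (q t + s * d t)%C; split; [now exists s |].
    change (g t < eps).
    assert (g theta = 0).
    { unfold g; rewrite <- Cmod_0; f_equal; ring. }
    change (Rabs (g t - g theta) < eps) in Ht.
    pose proof (Rle_abs (g t - g theta)); lra.
Qed.

(** Where [k] does not vanish the two points span the line with direction
    [d]; where it vanishes, the connecting line is the limit of such lines. *)
Lemma connecting_line_direction (p q d : R -> C) (k : R -> R) (theta : R) :
  continuous q theta -> continuous d theta ->
  (forall t, Cmod (d t) = 1) ->
  (forall t, p t - q t = k t * d t)%C ->
  locally' theta (fun t => k t <> 0) ->
  same_set (connecting_line p q theta) (line (q theta) (d theta)).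
Proof.
  intros Hq Hd Hu Hpq Hk.
  assert (Hline : forall t, p t <> q t ->
    same_set (line (q t) (d t)) (line_through (p t) (q t))).
  { intros t Hne; apply line_two_points.
    - exists (k t); rewrite <- Hpq; ring.
    - exists 0; ring.
    - exact Hne. }
  assert (Hnear : locally' theta (fun t =>
    same_set (line (q t) (d t)) (line_through (p t) (q t)))).
  { apply filter_imp with (2 := Hk); intros t Ht; apply Hline; intros E.
    apply (Cmult_neq_0 (k t) (d t)).
    - now apply RtoC_nz.
    - now apply unit_nz.
    - rewrite <- Hpq, E; ring. }
  intros z; split.
  - intros [[Hne Hz] | [_ Hz]].
    + now apply Hline.
    + apply limit_set_line; try assumption.
      intros eps; specialize (Hz eps).
      apply filter_imp with (2 := filter_and _ _ Hnear Hz).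
      intros t [Hs [w [Hw Hwz]]]; exists w; split; [now apply Hs | exact Hwz].
  - intros Hz.
    destruct (Ceq_dec (p theta) (q theta)) as [E | Hne].
    + right; split; [exact E |].
      apply limit_set_line in Hz; try assumption.
      intros eps; specialize (Hz eps).
      apply filter_imp with (2 := filter_and _ _ Hnear Hz).
      intros t [Hs [w [Hw Hwz]]]; exists w; split; [now apply Hs | exact Hwz].
    + left; split; [exact Hne | now apply Hline].
Qed.

(** At a zero [x], [cos y] is [- sin x * sin (y - x)] with [sin x <> 0], and
    [sin] does not vanish on the punctured interval of radius [PI]. *)
Lemma cos_zero_isolated (x : R) : locally' x (fun y => cos y <> 0).
Proof.
  assert (Hpi : 0 < PI) by apply PI_RGT_0.
  destruct (Req_dec (cos x) 0) as [Hx | Hx].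
  - exists (mkposreal PI Hpi); intros y Hy Hne Hcos.
    change (Rabs (y - x) < PI) in Hy.
    replace y with (x + (y - x)) in Hcos by ring.
    rewrite cos_plus, Hx in Hcos.
    assert (Hs : sin x <> 0).
    { intros Hs; pose proof (sin2_cos2 x) as H.
      rewrite Hs, Hx in H; unfold Rsqr in H; lra. }
    assert (H0 : sin (y - x) = 0).
    { apply Rmult_eq_reg_l with (sin x); [lra | exact Hs]. }
    apply Rabs_def2 in Hy.
    destruct (Rtotal_order (y - x) 0) as [Hlt | [Heq | Hgt]].
    + assert (0 < sin (- (y - x))) by (apply sin_gt_0; lra).
      rewrite sin_neg in *; lra.
    + apply Hne; lra.
    + assert (0 < sin (y - x)) by (apply sin_gt_0; lra); lra.
  - apply filter_le_within.
    assert (Hc : continuous cos x) by apply continuous_cos.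
    apply (Hc (fun v => v <> 0)).
    exists (mkposreal (Rabs (cos x)) (Rabs_pos_lt _ Hx)).
    intros y Hy E; subst y.
    change (Rabs (0 - cos x) < Rabs (cos x)) in Hy.
    rewrite Rabs_minus_sym, Rminus_0_r in Hy; lra.
Qed.

Lemma cos_zero_isolated_affine (c theta : R) :
  locally' theta (fun t => cos (3 * (t + c) / 2) <> 0).
Proof.
  destruct (cos_zero_isolated (3 * (theta + c) / 2)) as [e He].
  assert (He2 : 0 < e / 2) by (apply is_pos_div_2).
  exists (mkposreal _ He2); intros t Ht Hne.
  change (Rabs (t - theta) < e / 2) in Ht.
  apply He; [| lra].
  change (Rabs (3 * (t + c) / 2 - 3 * (theta + c) / 2) < e).
  apply Rabs_def2 in Ht; apply Rabs_def1; lra.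
Qed.

(** * The lines [L] and [L'] as tangents *)

(** The sum of two unit vectors points along the bisecting direction: the
    arguments [t] and [- 2 * t] have mean [- t / 2] and differ by [3 * t]. *)
Lemma cis_sum_half (t : R) :
  (2 * (cis t + cis (- 2 * t)) =
   (4 * cos (3 * t / 2))%R * cis (- t / 2))%C.
Proof.
  replace (cis t) with (cis (3 * t / 2 + - t / 2)) by (f_equal; field).
  replace (cis (- 2 * t)) with (cis (- (3 * t / 2) + - t / 2))
    by (f_equal; field).
  rewrite !cis_plus, cis_opp.
  unfold cis, Cconj, RtoC, Cplus, Cmult; simpl; f_equal; ring.
Qed.

(** The shift [c] serves to treat both families at once: [c = 0] gives [L]
    and [c = PI] gives [L'], as [cis (t + PI) = - cis t] while
    [cis (- 2 * t)] has period [PI]. *)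
Lemma connecting_line_is_deltoid_tangent (p q : R -> C) (c theta : R) :
  (forall t, p t = cis (- 2 * (t + c)) + 2 * cis (t + c))%C ->
  (forall t, q t = - cis (- 2 * (t + c)))%C ->
  same_set (connecting_line p q theta) (deltoid_tangent (theta + c)).
Proof.
  intros Hp Hq.
  assert (HL : same_set (connecting_line p q theta)
    (line (q theta) (cis (- (theta + c) / 2)))).
  { apply (connecting_line_direction p q (fun t => cis (- (t + c) / 2))
      (fun t => 4 * cos (3 * (t + c) / 2))).
    (* The shift by [PI] absorbs the sign of [q]. *)
    - apply continuous_ext with (f := fun t => cis (- 2 * (t + c) + PI)).
      + intros t; rewrite Hq; apply cis_PI.
      + apply continuous_cis, (ex_derive_continuous (V := R_NormedModule)).
        auto_derive; exact I.
    - apply continuous_cis, (ex_derive_continuous (V := R_NormedModule)).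
      auto_derive; exact I.
    - intros t; apply Cmod_cis.
    - intros t; rewrite <- cis_sum_half, Hp, Hq; ring.
    - apply filter_imp with (2 := cos_zero_isolated_affine c theta).
      intros t Ht; lra. }
  intros z; rewrite (HL z), Hq.
  pose proof (cis_sum_half (theta + c)) as E.
  set (k := 4 * cos (3 * (theta + c) / 2)) in E.
  unfold deltoid_tangent, deltoid_point.
  replace (2 * cis (theta + c) + cis (- 2 * (theta + c)))%C with
    (- cis (- 2 * (theta + c)) + k * cis (- (theta + c) / 2))%C
    by (rewrite <- E; ring).
  split; intros [s ->].
  - exists (s - k); rewrite RtoC_minus; ring.
  - exists (k + s); rewrite RtoC_plus; ring.
Qed.

Lemma line_L_tangent (theta : R) :
  same_set (line_L theta) (deltoid_tangent theta).
Proof.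
  rewrite <- (Rplus_0_r theta) at 2.
  apply connecting_line_is_deltoid_tangent; intros t; now rewrite Rplus_0_r.
Qed.

Lemma line_L'_tangent (theta : R) :
  same_set (line_L' theta) (deltoid_tangent (theta + PI)).
Proof.
  assert (H : forall t, cis (- 2 * (t + PI)) = cis (- 2 * t)).
  { intros t; rewrite !cis_m2, cis_PI; conj_push; ring. }
  apply connecting_line_is_deltoid_tangent; intros t; rewrite H.
  - rewrite cis_PI; ring.
  - reflexivity.
Qed.

Lemma tangent_family_envelope (F : R -> C -> Prop) (c : R) :
  (forall theta, same_set (F theta) (deltoid_tangent (theta + c))) ->
  deltoid_is_envelope F.
Proof.
  intros HF; split.
  - intros theta; exists (deltoid_point (theta + c)), (theta + c).
    split; [reflexivity | apply HF].
  - intros z [phi ->]; exists (phi - c), phi; split; [reflexivity |].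
    replace phi with (phi - c + c) at 2 by ring; apply HF.
Qed.

(** * Projections onto the sidelines of the large triangle *)

(** By [foot_on_chord] with radius [2]; the product [v * w] is [Cconj u].
    The vertices are permuted cyclically in the variables so that this one
    lemma covers the three sidelines. *)
Lemma simson_foot (u v w al : C) :
  Cmod u = 1 -> Cmod v = 1 -> Cmod w = 1 -> Cmod al = 1 ->
  (u * v * w)%C = 1%C -> v <> w ->
  is_orthogonal_projection (- (u + v + w) + 2 * al)%C
    (line_through (v - w - u) (w - u - v))%C
    (al - u - Cconj u * Cconj al)%C.
Proof.
  intros Hu Hv Hw Hal Hp Hvw.
  assert (E : (v * w)%C = Cconj u).
  { now apply (conj_of_unit_product u v w). }
  pose proof (foot_on_chord (- (u + v + w)) al v w 2 Hal Hv Hw Hvw) as H.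
  replace (v - w - u)%C with (- (u + v + w) + 2 * v)%C by ring.
  replace (w - u - v)%C with (- (u + v + w) + 2 * w)%C by ring.
  replace (al - u - Cconj u * Cconj al)%C with
    (- (u + v + w) + 2 * ((al + v + w - v * w * Cconj al) / 2))%C.
  - apply H; lra.
  - rewrite E; field.
Qed.

Lemma simson_foot_on_tangent (u : C) (phi : R) :
  Cmod u = 1 ->
  deltoid_tangent phi (cis phi - u - Cconj u * Cconj (cis phi))%C.
Proof.
  intros Hu; apply unit_conj in Hu.
  pose proof (unit_conj _ (Cmod_cis phi)) as Ha.
  apply deltoid_tangent_iff; conj_push; ring [Hu Ha].
Qed.

(** The difference of the two feet is
    [(u - v) * (w * Cconj al - 1)]. *)
Lemma simson_feet_eq (u v w al : C) :
  Cmod u = 1 -> Cmod v = 1 -> Cmod w = 1 -> Cmod al = 1 ->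
  (u * v * w)%C = 1%C -> u <> v ->
  (al - u - Cconj u * Cconj al = al - v - Cconj v * Cconj al)%C -> al = w.
Proof.
  intros Hu Hv Hw Hal Hp Huv E.
  assert (Eu : (v * w)%C = Cconj u).
  { now apply (conj_of_unit_product u v w). }
  assert (Ev : (u * w)%C = Cconj v).
  { apply (conj_of_unit_product v u w); [exact Hv | rewrite <- Hp; ring]. }
  apply unit_conj in Hal.
  rewrite <- Eu, <- Ev in E.
  apply Cmult_reg_l with (u - v)%C; [now apply Cminus_eq_contra |].
  apply Ceq_minus; apply Ceq_minus in E.
  transitivity (- al * 0)%C; [rewrite <- E; ring [Hal] | ring].
Qed.

(** A line containing the projections shares two distinct points with the
    tangent: if the feet belonging to [z1] and [z2] coincide then
    [cis phi = z3], so the feet belonging to [z1] and [z3], which coincide only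
    for [cis phi = z2], are distinct. *)
Lemma tangent_is_simson_line (z1 z2 z3 : C) (phi : R) (l : C -> Prop) :
  z1 <> z2 -> z1 <> z3 -> z2 <> z3 ->
  Cmod z1 = 1 -> Cmod z2 = 1 -> Cmod z3 = 1 ->
  (z1 * z2 * z3)%C = 1%C ->
  same_set l (deltoid_tangent phi) ->
  is_simson_line (z1 - z2 - z3) (z2 - z3 - z1) (z3 - z1 - z2)
    (- (z1 + z2 + z3) + 2 * cis phi) l.
Proof.
  intros h12 h13 h23 hz1 hz2 hz3 hprod Hl.
  pose proof (Cmod_cis phi) as Hal.
  assert (P1 := simson_foot z1 z2 z3 (cis phi) hz1 hz2 hz3 Hal hprod h23).
  assert (P2 : is_orthogonal_projection (- (z1 + z2 + z3) + 2 * cis phi)%C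
    (line_through (z3 - z1 - z2) (z1 - z2 - z3))%C
    (cis phi - z2 - Cconj z2 * Cconj (cis phi))%C).
  { replace (z1 + z2 + z3)%C with (z2 + z3 + z1)%C by ring.
    apply simson_foot; try assumption; [| congruence].
    rewrite <- hprod; ring. }
  assert (P3 : is_orthogonal_projection (- (z1 + z2 + z3) + 2 * cis phi)%C
    (line_through (z1 - z2 - z3) (z2 - z3 - z1))%C
    (cis phi - z3 - Cconj z3 * Cconj (cis phi))%C).
  { replace (z1 + z2 + z3)%C with (z3 + z1 + z2)%C by ring.
    apply simson_foot; try assumption.
    rewrite <- hprod; ring. }
  pose proof (simson_foot_on_tangent z1 phi hz1) as T1.
  pose proof (simson_foot_on_tangent z2 phi hz2) as T2.
  pose proof (simson_foot_on_tangent z3 phi hz3) as T3.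
  split; [| split; [| split]].
  - exists (- (z1 + z2 + z3))%C, 2.
    assert (Hc : forall x y : C, Cmod y = 1 ->
      x = (- (z1 + z2 + z3) + 2 * y)%C ->
      on_circle (- (z1 + z2 + z3))%C 2 x).
    { intros x y Hy ->; unfold on_circle.
      replace (_ - _)%C with (2 * y)%C by ring.
      rewrite Cmod_mult, Hy, Cmod_R, Rabs_pos_eq; lra. }
    repeat split; [apply (Hc _ z1) | apply (Hc _ z2) | apply (Hc _ z3)
      | apply (Hc _ (cis phi))]; trivial; ring.
  - exists (deltoid_point phi), (cis (- phi / 2)).
    split; [apply unit_nz, Cmod_cis | exact Hl].
  - repeat split; eexists; (split; [eassumption | now apply Hl]).
  - intros m [p [d [_ Hm]]] [[f1 [F1 M1]] [[f2 [F2 M2]] [f3 [F3 M3]]]].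
    rewrite (orthogonal_projection_unique _ _ _ _ F1 P1) in M1.
    rewrite (orthogonal_projection_unique _ _ _ _ F2 P2) in M2.
    rewrite (orthogonal_projection_unique _ _ _ _ F3 P3) in M3.
    apply Hm in M1; apply Hm in M2; apply Hm in M3.
    assert (Hjoin : forall f g : C, line p d f -> line p d g ->
      deltoid_tangent phi f -> deltoid_tangent phi g -> f <> g ->
      same_set m l).
    { intros f g Mf Mg Tf Tg Hne z.
      rewrite (Hm z), (Hl z), (line_two_points p d f g Mf Mg Hne z).
      symmetry; apply (line_two_points _ _ f g Tf Tg Hne). }
    destruct (Ceq_dec (cis phi - z1 - Cconj z1 * Cconj (cis phi))%C
                      (cis phi - z2 - Cconj z2 * Cconj (cis phi))%C)
      as [E | Hne].
    + apply (simson_feet_eq z1 z2 z3) in E; try assumption.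
      apply (Hjoin _ _ M1 M3 T1 T3); intros E'.
      apply (simson_feet_eq z1 z3 z2) in E'; try assumption; [congruence |].
      rewrite <- hprod; ring.
    + exact (Hjoin _ _ M1 M2 T1 T2 Hne).
Qed.

(** The side [b c] has midpoint [- u], the orthocenter is [h = u + v + w], and
    [u] is the midpoint of [a] and [h]. The foot of the altitude from [a] is
    the case [al = u] of [simson_foot], namely [- (Cconj u) ^ 2]. *)
Lemma nine_point_side (u v w : C) :
  Cmod u = 1 -> Cmod v = 1 -> Cmod w = 1 ->
  (u * v * w)%C = 1%C -> v <> w ->
  let a := (u - v - w)%C in
  let b := (v - w - u)%C in
  let c := (w - u - v)%C in
  let h := (u + v + w)%C in
  on_circle 0 1 (midpoint b c) /\
  contains_projection (on_circle 0 1) a (line_through b c) /\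
  dot (h - a) (c - b) = 0 /\
  on_circle 0 1 (midpoint a h).
Proof.
  intros Hu Hv Hw Hp Hvw a b c h; unfold a, b, c, h, on_circle, midpoint.
  split; [| split; [| split]].
  - replace (_ - 0)%C with (- u)%C by (field).
    now rewrite Cmod_opp.
  - eexists; split.
    + replace (u - v - w)%C with (- (u + v + w) + 2 * u)%C by ring.
      now apply simson_foot.
    + replace (_ - 0)%C with (- (Cconj u * Cconj u))%C by ring.
      rewrite Cmod_opp, Cmod_mult, Cmod_conj, Hu; ring.
  - apply unit_conj in Hv; apply unit_conj in Hw.
    apply dot_0_iff; conj_push; ring [Hv Hw].
  - replace (_ - 0)%C with u by (field).
    exact Hu.
Qed.

Theorem theorem2p3 (z1 z2 z3 : C)
  (h12 : z1 <> z2) (h13 : z1 <> z3) (h23 : z2 <> z3)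
  (hz1 : Cmod z1 = 1) (hz2 : Cmod z2 = 1) (hz3 : Cmod z3 = 1)
  (hprod : (z1 * z2 * z3)%C = 1%C) :
  let a := (z1 - z2 - z3)%C in
  let b := (- z1 + z2 - z3)%C in
  let c := (- z1 - z2 + z3)%C in
  is_nine_point_circle a b c 0%C 1 /\
  (forall (theta : R) (o : C) (r : R) (eps eps' : C),
     let alpha := cis theta in
     let alpha' := (- alpha)%C in
     is_circumcircle a b c o r ->
     opposite_ends o r eps eps' ->
     parallel (eps' - eps)%C (alpha' - alpha)%C ->
     same_order eps eps' alpha alpha' ->
     is_simson_line a b c eps (line_L theta) /\
     is_simson_line a b c eps' (line_L' theta)) /\
  deltoid_is_envelope line_L /\
  deltoid_is_envelope line_L'.
Proof.
  intros a b c.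
  replace b with (z2 - z3 - z1)%C by (unfold b; ring).
  replace c with (z3 - z1 - z2)%C by (unfold c; ring).
  unfold a; clear a b c.
  split; [| split; [| split]].
  - destruct (nine_point_side z1 z2 z3) as (A1 & A2 & A3 & A4); trivial.
    destruct (nine_point_side z2 z3 z1) as (B1 & B2 & B3 & B4); trivial.
    { rewrite <- hprod; ring. }
    { congruence. }
    destruct (nine_point_side z3 z1 z2) as (C1 & C2 & C3 & C4); trivial.
    { rewrite <- hprod; ring. }
    replace (z2 + z3 + z1)%C with (z1 + z2 + z3)%C in * by ring.
    replace (z3 + z1 + z2)%C with (z1 + z2 + z3)%C in * by ring.
    repeat split; trivial.
    exists (z1 + z2 + z3)%C; repeat split; trivial.
  - intros theta o r eps eps' Hcirc Hends Hpar Hord.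
    destruct (ordered_diameter_ends o eps eps' (cis theta) r) as [E E'];
      trivial; [apply Cmod_cis |].
    destruct (circumcircle_unique (- (z1 + z2 + z3)) z1 z2 z3 o 2 r)
      as [Ho Hr]; trivial; [lra | |].
    { replace (- (z1 + z2 + z3) + 2 * z1)%C with (z1 - z2 - z3)%C by ring.
      replace (- (z1 + z2 + z3) + 2 * z2)%C with (z2 - z3 - z1)%C by ring.
      replace (- (z1 + z2 + z3) + 2 * z3)%C with (z3 - z1 - z2)%C by ring.
      exact Hcirc. }
    subst o r eps eps'; split.
    + apply tangent_is_simson_line; trivial; apply line_L_tangent.
    + rewrite <- cis_PI.
      apply tangent_is_simson_line; trivial; apply line_L'_tangent.
  - apply (tangent_family_envelope line_L 0); intros theta.
    rewrite Rplus_0_r; apply line_L_tangent.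
  - exact (tangent_family_envelope line_L' PI line_L'_tangent).
Qed.
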